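(* Let $d\ge1$, $n\ge1$, let $\mathbf x_1,\dots,\mathbf x_n\in\mathbb R^d$ and $\mathbb P_n=\frac1n\sum_{i=1}^n\delta_{\{\mathbf x_i\}}$. For non-empty $I\subseteq\{1,\dots,n\}$ let $B_I$ be the closed ball centered at $\sum_{i\in I}\mathbf x_i/|I|$ with radius $\delta n/|I|$. Let $\mathcal C$ be the class of sets $I\subseteq\{1,\dots,n\}$ such that $\{\mathbf x_i:i\in I\}$ and $\{\mathbf x_i:i\notin I\}$ can be separated by a hyperplane. For $\delta>0$ such that $\overline\alpha(\delta)=\max_{\mathbf z}D_\delta(\mathbf z|\mathbb P_n)=1$, the median region $M_\delta=\{\mathbf z\in\mathbb R^d:D_\delta(\mathbf z|\mathbb P_n)=1\}$ satisfies $$M_\delta=\bigcap_{I\in\mathcal C,\,I\ne\emptyset}B_I=\bigcap_{\emptyset\ne I\subseteq\{1,\dots,n\}}B_I .$$ Moreover, for $\delta$ large enough $M_\delta$ is the closed ball of radius $\delta$ centered at $\sum_{i=1}^n\mathbf x_i/n$.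
   Context: $\delta_{\{\mathbf x\}}$ is the Dirac mass at $\mathbf x$, $\|\cdot\|$ the Euclidean norm, $\langle\cdot,\cdot\rangle$ the Euclidean inner product. For laws $\mathbb P,\mathbb P'$ on $\mathbb R^d$ the Wasserstein distance is $d_W(\mathbb P,\mathbb P')=\inf_\Pi\int\|\mathbf x-\mathbf y\|\,\Pi(\mathrm d\mathbf x,\mathrm d\mathbf y)\in[0,\infty]$, over all joint laws $\Pi$ with marginals $\mathbb P,\mathbb P'$. The robustified halfspace depth is $$D_\delta(\mathbf z|\mathbb P)=\inf_{\|\mathbf u\|=1}\ \sup_{\mathbb P':d_W(\mathbb P',\mathbb P)\le\delta}\mathbb P'(\{\mathbf x\in\mathbb R^d:\langle\mathbf u,\mathbf x-\mathbf z\rangle\ge0\}).$$ Two finite sets are separated by a hyperplane if they lie in the two opposite open halfspaces determined by the hyperplane; the empty set is separated from any finite set (so $\{1,\dots,n\}\in\mathcal C$). *)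

(* Defs.v *)
From HB Require Import structures.
From mathcomp Require Import all_boot all_order all_algebra.
From mathcomp Require Import all_classical all_reals all_analysis.
Set Implicit Arguments.
Unset Strict Implicit.
Unset Printing Implicit Defensive.
Import Order.TTheory GRing.Theory Num.Theory.
Import numFieldNormedType.Exports.
Local Open Scope classical_set_scope.
Local Open Scope ring_scope.

(* The norm `|x| of the library on 'rV[R]_d is the sup norm, hence the
   Euclidean structure below. Both norms induce the same open sets. *)
Definition dot (R : realType) (d : nat) (u v : 'rV[R]_d) : R :=
  \sum_(j < d) u 0 j * v 0 j.

Definition enorm (R : realType) (d : nat) (u : 'rV[R]_d) : R :=
  Num.sqrt (dot u u).

Definition ecball (R : realType) (d : nat) (c : 'rV[R]_d) (r : R) :
  set 'rV[R]_d := [set z | enorm (z - c) <= r].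

Definition borelRd (R : realType) (d : nat) :
    measurableType (sigma_display (@open 'rV[R]_d)) :=
  g_sigma_algebraType (@open 'rV[R]_d).

Definition law (R : realType) (d : nat) := probability (borelRd R d) R.

Definition is_coupling (R : realType) (d : nat) (P Q : law R d)
    (Pi : probability (borelRd R d * borelRd R d)%type R) : Prop :=
  forall A : set (borelRd R d), measurable A ->
    Pi (fst @^-1` A) = P A /\ Pi (snd @^-1` A) = Q A.

Definition wasserstein (R : realType) (d : nat) (P Q : law R d) : \bar R :=
  ereal_inf [set (\int[Pi]_p (enorm (p.1 - p.2 : 'rV[R]_d))%:E)%E |
             Pi in [set Pi | is_coupling P Q Pi]].

Definition halfspace (R : realType) (d : nat) (u z : 'rV[R]_d) :
  set (borelRd R d) := [set y | 0 <= dot u ((y : 'rV[R]_d) - z)].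

Definition robust_depth (R : realType) (d : nat) (delta : R) (P : law R d)
    (z : 'rV[R]_d) : \bar R :=
  ereal_inf [set ereal_sup [set (Q : law R d) (halfspace u z) |
                            Q in [set Q | (wasserstein Q P <= delta%:E)%E]] |
             u in [set u : 'rV[R]_d | enorm u = 1]].

Definition is_max_value (T : Type) (R : realType) (f : T -> \bar R)
    (m : \bar R) : Prop :=
  (exists z, f z = m) /\ (forall z, (f z <= m)%E).

Definition empirical (R : realType) (d n : nat) (n_gt0 : (0 < n)%N)
    (x : 'I_n -> 'rV[R]_d) (A : set (borelRd R d)) : \bar R :=
  ((n%:R^-1)%:E * \sum_(i < n) \d_(x i : borelRd R d) A)%E.

Section empirical_probability.
Context (R : realType) (d n : nat) (n_gt0 : (0 < n)%N) (x : 'I_n -> 'rV[R]_d).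

Let invn_ge0 : 0 <= (n%:R^-1 : R).
Proof. by rewrite invr_ge0. Qed.

Let empiricalE : empirical n_gt0 x =
  mscale (NngNum invn_ge0) (msum (fun k =>
    \d_(x (insubd (Ordinal n_gt0) k) : borelRd R d)) n).
Proof.
apply/funext => A; rewrite /empirical /mscale /msum /=; congr (_ * _)%E.
by apply: eq_bigr => i _; rewrite valKd.
Qed.

Let empirical0 : empirical n_gt0 x set0 = 0%E.
Proof. by rewrite empiricalE measure0. Qed.

Let empirical_ge0 A : (0 <= empirical n_gt0 x A)%E.
Proof. by rewrite empiricalE. Qed.

Let empirical_sigma_additive : semi_sigma_additive (empirical n_gt0 x).
Proof. by rewrite empiricalE; exact: measure_semi_sigma_additive. Qed.

HB.instance Definition _ := isMeasure.Build _ _ _ (empirical n_gt0 x)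
  empirical0 empirical_ge0 empirical_sigma_additive.

Let empirical_setT : empirical n_gt0 x setT = 1%E.
Proof.
rewrite /empirical (eq_bigr (fun=> 1%E)); last first.
  by move=> i _; rewrite diracT.
rewrite sumEFin -EFinM sumr_const card_ord -[1 *+ n]/(n%:R) mulVf //.
by rewrite pnatr_eq0 -lt0n.
Qed.

HB.instance Definition _ := Measure_isProbability.Build _ _ _
  (empirical n_gt0 x) empirical_setT.

End empirical_probability.

Definition median_region (R : realType) (d : nat) (delta : R) (P : law R d) :
  set 'rV[R]_d := [set z | robust_depth delta P z = 1%E].

Definition centroid (R : realType) (d n : nat) (x : 'I_n -> 'rV[R]_d)
    (I : {set 'I_n}) : 'rV[R]_d := (#|I|%:R)^-1 *: \sum_(i in I) x i.

Definition ballI (R : realType) (d n : nat) (delta : R)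
    (x : 'I_n -> 'rV[R]_d) (I : {set 'I_n}) : set 'rV[R]_d :=
  ecball (centroid x I) (delta * n%:R / #|I|%:R).

Definition separated_by_hyperplane (R : realType) (d : nat)
    (A B : set 'rV[R]_d) : Prop :=
  exists (a : 'rV[R]_d) (b : R), a != 0 /\
    (forall y, A y -> dot a y < b) /\ (forall y, B y -> b < dot a y).

Definition separable_index (R : realType) (d n : nat)
    (x : 'I_n -> 'rV[R]_d) (I : {set 'I_n}) : Prop :=
  separated_by_hyperplane [set x i | i in [set i | i \in I]]
                          [set x i | i in [set i | i \notin I]].

(* When 0 < d, the convention that the empty set is separated from any finite
   set is a consequence of the definition. *)
Lemma separable_index_setT (R : realType) (d n : nat) (x : 'I_n -> 'rV[R]_d) :
  (0 < d)%N -> separable_index x [set: 'I_n]%SET.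
Proof.
move=> d_gt0; exists (const_mx 1), (1 + \sum_(i < n) `|dot (const_mx 1) (x i)|).
split; [|split].
- apply/eqP => /matrixP/(_ 0 (Ordinal d_gt0)); rewrite !mxE => /eqP.
  by rewrite oner_eq0.
- move=> _ [i _ <-]; rewrite (bigD1 i) //= addrCA.
  apply: le_lt_trans (ler_norm _) _; rewrite ltrDl.
  by apply: ltr_wpDr => //; exact: sumr_ge0.
- by move=> _ [i /= + <-]; rewrite inE.
Qed.

(* Main.v *)
Require Import Defs.
From mathcomp Require Import all_boot all_order all_algebra.
From mathcomp Require Import all_classical all_reals all_analysis.
From mathcomp Require Import measurable_realfun lra.
Import Order.TTheory GRing.Theory Num.Theory.
Import numFieldNormedType.Exports.
Local Open Scope classical_set_scope.
Local Open Scope ring_scope.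

(** A law [Q] at Wasserstein distance at most [delta] from [P_n] with
    [Q (halfspace u z) = 1] exists iff the cheapest transport into the
    halfspace, which pushes every sample point orthogonally onto it, costs
    [n^-1 * \sum_i max(0, <u, z - x_i>) <= delta]; otherwise the mass that
    stays outside is bounded away from [0].  Hence [z] has depth [1] iff this
    holds for all unit [u].  Since [\sum_i max(0, a_i)] is the largest of the
    partial sums [\sum_(i in I) a_i], and the supremum over [u] of such a
    partial sum is [|I|] times the distance from [z] to the centroid of the
    [x_i], [i] in [I], this says that [z] lies in all the balls [B_I].  The
    maximal partial sum is attained at [I = {i | <u, x_i> < <u, z>}], a subset
    cut off by a hyperplane, so the separable [I] already suffice. *)

(** * Euclidean geometry *)

Section euclidean.
Context (R : realType) (d : nat).
Implicit Types (u v w : 'rV[R]_d) (a r : R).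

Lemma dotC u v : dot u v = dot v u.
Proof. by apply: eq_bigr => j _; rewrite mulrC. Qed.

Lemma dotDr u v w : dot u (v + w) = dot u v + dot u w.
Proof. by rewrite -big_split; apply: eq_bigr => j _; rewrite mxE mulrDr. Qed.

Lemma dotZr a u v : dot u (a *: v) = a * dot u v.
Proof. by rewrite mulr_sumr; apply: eq_bigr => j _; rewrite mxE mulrCA. Qed.

Lemma dotBr u v w : dot u (v - w) = dot u v - dot u w.
Proof. by rewrite dotDr -scaleN1r dotZr mulN1r. Qed.

Lemma dot_sumr (I : finType) (P : pred I) u (F : I -> 'rV[R]_d) :
  dot u (\sum_(i | P i) F i) = \sum_(i | P i) dot u (F i).
Proof.
apply: (big_morph (dot u) (dotDr u)).
by rewrite -(scale0r (0 : 'rV[R]_d)) dotZr mul0r.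
Qed.

Lemma dot_ge0 u : 0 <= dot u u.
Proof. by apply: sumr_ge0 => j _; rewrite -expr2 sqr_ge0. Qed.

Lemma enorm_ge0 u : 0 <= enorm u.
Proof. exact: sqrtr_ge0. Qed.

Lemma enorm_sqr u : enorm u ^+ 2 = dot u u.
Proof. by rewrite sqr_sqrtr // dot_ge0. Qed.

Lemma enormZ a u : enorm (a *: u) = `|a| * enorm u.
Proof.
by rewrite /enorm dotZr dotC dotZr mulrA -expr2 sqrtrM ?sqr_ge0 // sqrtr_sqr.
Qed.

(** Cauchy-Schwarz, read off from the nonnegative squared norm of the component of [v] orthogonal to
    [u]. *)
Lemma dot_le_enorm u v : enorm u = 1 -> dot u v <= enorm v.
Proof.
move=> u1; have uu : dot u u = 1 by rewrite -enorm_sqr u1 expr1n.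
have : 0 <= dot (v - dot u v *: u) (v - dot u v *: u) by exact: dot_ge0.
rewrite dotBr dotZr ![dot (_ - _) _]dotC !dotBr !dotZr uu (dotC v u) => h.
apply: le_trans (ler_norm _) _; rewrite -sqrtr_sqr ler_wsqrtr //.
by move: h; rewrite expr2; lra.
Qed.

Lemma exists_unit_dot v : enorm v != 0 ->
  exists2 u, enorm u = 1 & dot u v = enorm v.
Proof.
move=> v0; exists ((enorm v)^-1 *: v).
  by rewrite enormZ ger0_norm ?invr_ge0 ?enorm_ge0 // mulVf.
by rewrite dotC dotZr -enorm_sqr expr2 mulKf.
Qed.

(** Duality turns a norm bound into a family of linear inequalities. A vector of norm zero is
    settled by [0 <= r], any other one by its own direction. *)
Lemma enorm_leP v r : 0 <= r ->
  enorm v <= r <-> (forall u, enorm u = 1 -> dot u v <= r).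
Proof.
move=> r0; split=> [vr u u1|h]; first exact: le_trans (dot_le_enorm u v u1) vr.
have [->//|v0] := eqVneq (enorm v) 0.
by have [u u1 <-] := exists_unit_dot v v0; exact: h.
Qed.

Lemma enormD v w : enorm (v + w) <= enorm v + enorm w.
Proof.
apply/enorm_leP; first by rewrite addr_ge0 ?enorm_ge0.
by move=> u u1; rewrite dotDr lerD // dot_le_enorm.
Qed.

Lemma exists_unit_vector : (0 < d)%N -> exists u, enorm u = 1.
Proof.
move=> d_gt0; have [|u u1 _] := exists_unit_dot (const_mx 1); last by exists u.
rewrite sqrtr_eq0 -ltNge /dot (bigD1 (Ordinal d_gt0)) //= !mxE mulr1.
by apply: ltr_wpDr => //; apply: sumr_ge0 => i _; rewrite !mxE mulr1.
Qed.

End euclidean.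

(** * Balls and hyperplane-separated subfamilies *)

Section balls.
Context (R : realType) (d n : nat) (n_gt0 : (0 < n)%N) (x : 'I_n -> 'rV[R]_d).
Implicit Types (u z : 'rV[R]_d) (delta : R) (I : {set 'I_n}).

(* The cost, per unit of mass [1/n], of transporting the sample into the
   halfspace [halfspace u z]. *)
Definition transport_cost u z := \sum_(i < n) Num.max 0 (dot u (z - x i)).

Lemma transport_cost_ge u z I :
  \sum_(i in I) dot u (z - x i) <= transport_cost u z.
Proof.
rewrite big_mkcond; apply: ler_sum => i _.
by rewrite le_max; case: ifP; rewrite lexx ?orbT.
Qed.

Lemma transport_costE u z :
  transport_cost u z = \sum_(i in [set i | 0 < dot u (z - x i)]%SET)
                        dot u (z - x i).
Proof.
rewrite [RHS]big_mkcond; apply: eq_bigr => i _; rewrite inE.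
by case: ltP => // h; rewrite ?(max_idPr (ltW h)) ?(max_idPl h).
Qed.

(** Multiplying by [#|I|] clears the denominator of the centroid and turns the radius into
    [delta * n%:R], a bound common to all [I]. *)
Lemma ballIP delta I z : 0 <= delta -> I != finset.set0 ->
  ballI delta x I z <->
  (forall u, enorm u = 1 -> \sum_(i in I) dot u (z - x i) <= delta * n%:R).
Proof.
move=> delta0; rewrite -cards_eq0 => I0.
have cI : 0 < (#|I|%:R : R) by rewrite ltr0n lt0n.
have E u : dot u (z - centroid x I) * #|I|%:R = \sum_(i in I) dot u (z - x i).
  rewrite dotBr /centroid dotZr dot_sumr mulrBl mulrAC mulVf ?gt_eqF // mul1r.
  under [RHS]eq_bigr do rewrite dotBr.
  by rewrite big_split /= sumrN sumr_const mulr_natr.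
rewrite /ballI /ecball /=.
split=> [/enorm_leP h u u1|h].
  rewrite -E -ler_pdivlMr //; apply: h => //.
  by rewrite divr_ge0 ?mulr_ge0.
apply/enorm_leP; first by rewrite divr_ge0 ?mulr_ge0.
by move=> u u1; rewrite ler_pdivlMr // E; exact: h.
Qed.

Lemma separable_halfspace u z : enorm u = 1 ->
  separable_index x [set i | 0 < dot u (z - x i)]%SET.
Proof.
move=> u1; pose J := [set i | 0 < dot u (z - x i)]%SET.
(* The least gap over [J], capped at [1] so that [J] may be empty. Points indexed by [J] have level
   at most [dot u z - e], the others at least [dot u z]; the hyperplane goes halfway between. *)
pose e := \big[Num.min/1]_(i in J) dot u (z - x i).
have e0 : 0 < e.
  apply: (big_ind (fun y => 0 < y)) => // [y w y0 w0|i]; last by rewrite inE.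
  by rewrite lt_min y0.
exists u, (dot u z - e / 2); split; last split.
- apply/eqP => u0; move: u1; rewrite u0 -(scale0r (0 : 'rV[R]_d)) enormZ.
  by rewrite normr0 mul0r => /esym/eqP; rewrite oner_eq0.
- move=> _ [i /= iJ <-]; have : e <= dot u (z - x i).
    by rewrite /e (bigD1 i) //= ge_min lexx.
  by rewrite dotBr; lra.
- move=> _ [i /= + <-]; rewrite inE -leNgt dotBr; lra.
Qed.

Lemma transport_cost_le delta z : 0 <= delta ->
  (forall I, separable_index x I -> I != finset.set0 -> ballI delta x I z) ->
  forall u, enorm u = 1 -> transport_cost u z <= delta * n%:R.
Proof.
move=> delta0 h u u1; rewrite transport_costE; set J := [set i | _]%SET.
have [->|J0] := eqVneq J finset.set0; first by rewrite big_set0 mulr_ge0.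
have /(ballIP delta J z delta0 J0) := h J (separable_halfspace u z u1) J0.
exact.
Qed.

Lemma ballI_transport_cost delta z : 0 <= delta ->
  (forall u, enorm u = 1 -> transport_cost u z <= delta * n%:R) ->
  forall I, I != finset.set0 -> ballI delta x I z.
Proof.
move=> delta0 h I I0; apply/ballIP => // u u1.
exact: le_trans (transport_cost_ge u z I) (h u u1).
Qed.

Lemma ballI_setT delta :
  ballI delta x [set: 'I_n]%SET = ecball (n%:R^-1 *: \sum_(i < n) x i) delta.
Proof.
rewrite /ballI /centroid cardsT card_ord mulfK ?pnatr_eq0 -?lt0n //.
by congr (ecball (_ *: _) _); apply: eq_bigl => i; rewrite inE.
Qed.

(* The radii [delta * n / #|I|] of the proper subfamilies exceed [delta] by at
   least [delta / n], which eventually absorbs the distances between centers. *)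
Lemma bigcap_ballI_large : exists2 delta0 : R, 0 < delta0 &
  forall delta, delta0 <= delta ->
    \bigcap_(I in [set I : {set 'I_n} | I != finset.set0]) ballI delta x I =
    ecball (n%:R^-1 *: \sum_(i < n) x i) delta.
Proof.
pose D I := enorm (centroid x [set: 'I_n]%SET - centroid x I).
pose K := \sum_(I : {set 'I_n}) D I.
have K0 : 0 <= K by apply: sumr_ge0 => I _; exact: enorm_ge0.
have nR : 0 < (n%:R : R) by rewrite ltr0n.
exists (1 + n%:R * K) => [|delta hdelta]; first by rewrite ltr_pwDl // mulr_ge0.
have delta0 : 0 <= delta by apply: le_trans hdelta; rewrite addr_ge0 ?mulr_ge0.
rewrite -ballI_setT; apply/seteqP; split=> z.
  by apply; rewrite /= -card_gt0 cardsT card_ord.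
move=> zT I /= I0; have [->//|IT] := eqVneq I [set: 'I_n]%SET.
have cI : 0 < (#|I|%:R : R) by rewrite ltr0n card_gt0.
have In : (#|I| < n)%N.
  rewrite -[X in (_ < X)%N]card_ord -cardsT; apply: proper_card.
  by rewrite properT.
have In' : #|I|%:R + 1 <= (n%:R : R) by rewrite natr1 ler_nat.
have DK : D I <= K.
  by rewrite /K (bigD1 I) //= lerDl sumr_ge0 // => J _; exact: enorm_ge0.
have D0 : 0 <= D I by exact: enorm_ge0.
move: zT; rewrite /ballI /ecball /= cardsT card_ord mulfK ?gt_eqF // => zT.
rewrite ler_pdivlMr //.
have : enorm (z - centroid x I) <= delta + D I.
  rewrite -(subrKA (centroid x [set: 'I_n]%SET)).
  by apply: le_trans (enormD _ _ _ _) _; rewrite lerD2r.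
(* Times [#|I|], the excess [#|I| * D I] is at most [n%:R * K <= delta], and [#|I| + 1 <= n] leaves
   room for one more [delta]. *)
by have := enorm_ge0 R d (z - centroid x I); nra.
Qed.

End balls.

(** * Measurability on [borelRd] *)

Section measurability.
Context (R : realType) (d : nat).

Lemma measurable_coord j :
  measurable_fun [set: borelRd R d] (fun y : borelRd R d => (y : 'rV[R]_d) 0 j).
Proof.
(* Open intervals generate the Borel sets of the line, and their preimages under a continuous
   coordinate are open. *)
apply: (measurability _ (RGenOpens.measurableE R)).
move=> _ [_ [a [b ->] <-]]; rewrite setTI; apply: sub_sigma_algebra.
apply: open_comp; last exact: interval_open.
by move=> y _; exact: coord_continuous.
Qed.

Lemma measurable_dot_sub {d' : measure_display} {T : measurableType d'}
    {u z : 'rV[R]_d} {f : T -> borelRd R d} :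
  measurable_fun [set: T] f ->
  measurable_fun [set: T] (fun t => dot u (z - (f t : 'rV[R]_d))).
Proof.
move=> mf; apply: measurable_sum => j; apply: measurable_funM => //.
under eq_fun do rewrite !mxE.
apply: measurable_funB => //.
exact: measurableT_comp (measurable_coord j) mf.
Qed.

Lemma measurable_halfspace (u z : 'rV[R]_d) : measurable (halfspace u z).
Proof.
have -> : halfspace u z =
    [set: borelRd R d] `&` (fun y => dot u (z - y)) @^-1` `]-oo, 0]%classic.
  apply/seteqP; split=> y; rewrite /halfspace /= in_itv /= !dotBr.
    by split=> //; lra.
  by case=> _; lra.
by apply: (measurable_dot_sub (@measurable_id _ _ _)).
Qed.

Lemma measurable_enorm_sub :
  measurable_fun [set: borelRd R d * borelRd R d]
    (fun p => enorm (p.1 - p.2 : 'rV[R]_d)).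
Proof.
apply: (measurableT_comp (continuous_measurable_fun (@sqrt_continuous R))).
apply: measurable_sum => j; rewrite -[X in measurable_fun _ X]/(_ \* _).
suff mj : measurable_fun [set: borelRd R d * borelRd R d]
    (fun p => (p.1 - p.2 : 'rV[R]_d) 0 j) by exact: measurable_funM.
under eq_fun do rewrite !mxE.
apply: measurable_funB.
- exact: measurableT_comp (measurable_coord j) measurable_fst.
- exact: measurableT_comp (measurable_coord j) measurable_snd.
Qed.

End measurability.

(** * Uniform measures on finite families *)

Section uniform_measure.
Context (R : realType) (d' : measure_display) (T : measurableType d') (n : nat)
  (n_gt0 : (0 < n)%N) (t : 'I_n -> T).

(** Supplies the discrete coupling on the product space that realizes a transport of the sample. *)
Lemma exists_uniform_probability : exists P : probability T R,
  forall A, P A = ((n%:R^-1)%:E * \sum_(i < n) \d_(t i) A)%E.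
Proof.
(* [msum] is indexed by natural numbers; the default of [insubd] is only taken from [n] on, outside
   the sum. *)
pose mu := msum (fun k => \d_(t (insubd (Ordinal n_gt0) k))) n
  : {measure set T -> \bar R}.
(* The Dirac mass is the fallback of [mnormalize] for total mass zero or infinite; here the mass is
   [n]. *)
exists (mnormalize mu (\d_(t (Ordinal n_gt0)))) => A.
have muE B : mu B = (\sum_(i < n) \d_(t i) B)%E.
  by apply: eq_bigr => i _; rewrite valKd.
have muT : mu setT = n%:R%:E.
  rewrite muE (eq_bigr (fun=> 1%E)); last by move=> i _; rewrite diracT.
  by rewrite sumEFin sumr_const card_ord.
rewrite /= /mnormalize muT /= orbF eqe pnatr_eq0 gtn_eqF //= muE.
by rewrite muleC.
Qed.

Lemma integral_uniform (P : {measure set T -> \bar R}) (f : T -> R) :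
  (forall A, P A = ((n%:R^-1)%:E * \sum_(i < n) \d_(t i) A)%E) ->
  (forall y, 0 <= f y) -> measurable_fun [set: T] f ->
  (\int[P]_y (f y)%:E = (n%:R^-1 * \sum_(i < n) f (t i))%:E)%E.
Proof.
move=> PE f0 mf.
have n0 : 0 <= (n%:R^-1 : R) by rewrite invr_ge0.
pose mu := msum (fun k => \d_(t (insubd (Ordinal n_gt0) k))) n
  : {measure set T -> \bar R}.
have mEf : measurable_fun [set: T] (EFin \o f) by exact/measurable_EFinP.
rewrite (eq_measure_integral (mscale (NngNum n0) mu)); last first.
  move=> A _ _; rewrite PE /= /mscale /= /msum; congr (_ * _)%E.
  by apply: eq_bigr => i _; rewrite valKd.
rewrite ge0_integral_mscale //; last by move=> y _; rewrite lee_fin.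
rewrite ge0_integral_measure_sum //; last by move=> y _; rewrite lee_fin.
rewrite EFinM -sumEFin; congr (_ * _)%E; apply: eq_bigr => i _.
by rewrite integral_dirac // diracT mul1e valKd.
Qed.

End uniform_measure.

(** * Depth and transport cost *)

Section depth.
Context (R : realType) (d n : nat) (n_gt0 : (0 < n)%N) (x : 'I_n -> 'rV[R]_d).
Implicit Types (u z : 'rV[R]_d) (delta : R).

Let P : law R d := empirical n_gt0 x.

Let nR : 0 < (n%:R : R).
Proof. by rewrite ltr0n. Qed.

Lemma exists_law_halfspace1 delta u z : enorm u = 1 ->
  transport_cost R d n x u z <= delta * n%:R ->
  exists2 Q : law R d,
    (wasserstein Q P <= delta%:E)%E & Q (halfspace u z) = 1%E.
Proof.
move=> u1 cost; have uu : dot u u = 1 by rewrite -enorm_sqr u1 expr1n.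
(* Each point moves along [u] by exactly what it lacks to reach the halfspace, so its displacement
   has length [Num.max 0 (dot u (z - x i))]. *)
pose y i := x i + Num.max 0 (dot u (z - x i)) *: u.
pose t i : borelRd R d * borelRd R d := (y i, x i).
have [Pi PiE] := exists_uniform_probability R _ _ n n_gt0 t.
exists (empirical n_gt0 y); last first.
  rewrite /= /empirical (eq_bigr (fun=> 1%E)) => [|i _].
    by rewrite sumEFin sumr_const card_ord -EFinM mulVf ?gt_eqF.
  rewrite diracE mem_set //= /halfspace /= /y dotBr dotDr dotZr uu mulr1.
  have := le_max (dot u (z - x i)) 0 (dot u (z - x i)).
  by rewrite lexx orbT dotBr; lra.
apply: le_trans (ereal_inf_lbound _) _.
  exists Pi; last by [].
  by move=> A _; rewrite !PiE /= /empirical.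
rewrite (integral_uniform R _ _ n n_gt0 t Pi) //; last first.
- exact: measurable_enorm_sub.
- by move=> p; exact: enorm_ge0.
rewrite lee_fin ler_pdivrMl // mulrC.
rewrite (eq_bigr (fun i => Num.max 0 (dot u (z - x i)))) // => i _.
by rewrite /= /y addrAC subrr add0r enormZ u1 mulr1 ger0_norm // le_max lexx.
Qed.

(* On [halfspace u z] the distance to [y] is at least [dot u (z - y)], so
   the mass [Q] leaves outside accounts for the missing cost. *)
Lemma transport_cost_le_wasserstein (Q : law R d) u z (M : R) : enorm u = 1 ->
  (forall i, Num.max 0 (dot u (z - x i)) <= M) -> 0 <= M ->
  ((n%:R^-1 * transport_cost R d n x u z)%:E <=
    wasserstein Q P + M%:E * (1 - Q (halfspace u z)))%E.
Proof.
move=> u1 hM M0; have mH := measurable_halfspace R d u z.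
have finMQ : (M%:E * (1 - Q (halfspace u z)))%E \is a fin_num.
  rewrite -(probability_setC Q) // fin_numM // fin_num_measure //.
  exact: measurableC.
(* With the finite outside term on the left, the infimum can be bounded one coupling at a time. *)
rewrite -leeBlDr //.
apply: le_ereal_inf_tmp => _ [Pi cPi <-].
rewrite leeBlDr //.
(* Truncation at [M] bounds the cost of mass left outside; by [hM] it changes nothing at the sample
   points. *)
pose g (w : borelRd R d) := Num.min M (Num.max 0 (dot u (z - (w : 'rV[R]_d)))).
have g0 w : 0 <= g w by rewrite /g le_min M0 le_max lexx.
have mg : measurable_fun [set: borelRd R d] g.
  apply: measurable_minr => //; apply: measurable_maxr => //.
  exact: (measurable_dot_sub _ _ (@measurable_id _ _ _)).
pose H := @halfspace R d u z.
have mE : measurable_fun [set: borelRd R d * borelRd R d]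
    (fun p => (enorm (p.1 - p.2 : 'rV[R]_d))%:E).
  by apply/measurable_EFinP; exact: measurable_enorm_sub.
have mF : measurable (fst @^-1` (~` H) : set (borelRd R d * borelRd R d)).
  rewrite -[X in measurable X]setTI; apply: measurable_fst => //.
  exact: measurableC.
have -> : (n%:R^-1 * transport_cost R d n x u z)%:E =
          (\int[Pi]_p (g p.2)%:E)%E.
  transitivity (\int[P]_w (g w)%:E)%E.
    rewrite (integral_uniform R _ _ n n_gt0 (x : 'I_n -> borelRd R d) P) //.
    congr (_ * _)%:E; apply: eq_bigr => i _.
    by rewrite /g; symmetry; apply/min_idPr.
  rewrite (eq_measure_integral (pushforward Pi snd)).
    rewrite ge0_integral_pushforward //; first exact/measurable_EFinP.
    by move=> w _; rewrite lee_fin.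
  by move=> A mA _; exact: esym (cPi A mA).2.
rewrite -(probability_setC Q) // -(cPi _ (measurableC mH)).1.
rewrite -[fst @^-1` _]setIT -(integral_indic Pi) //.
have mI : measurable_fun [set: borelRd R d * borelRd R d]
    (fun p => (\1_(fst @^-1` (~` H)) p)%:E : \bar R).
  by apply/measurable_EFinP; exact: measurable_indic.
rewrite -ge0_integralZl_EFin //.
rewrite -ge0_integralD //; last 3 first.
- by move=> p _; rewrite lee_fin enorm_ge0.
- by move=> p _; rewrite mule_ge0 // lee_fin.
- by apply: emeasurable_funM.
apply: ge0_le_integral => //.
- by move=> p _; rewrite lee_fin.
- apply/measurable_EFinP; exact: measurableT_comp mg measurable_snd.
- by apply: emeasurable_funD => //; exact: emeasurable_funM.
move=> p _; rewrite -EFinM -EFinD lee_fin indicE /g.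
(* If [p.1] is in the halfspace, then [dot u (z - p.2) <= dot u (p.1 - p.2)], at most the distance;
   otherwise [g p.2 <= M] suffices. *)
have [pH|pH] := pselect (H p.1).
  rewrite memNset; last by [].
  rewrite mulr0 addr0 ge_min ge_max enorm_ge0 /=; apply/orP; right.
  apply: le_trans (dot_le_enorm _ _ _ _ u1).
  by move: pH; rewrite /H /halfspace /= !dotBr; lra.
rewrite mem_set // mulr1 ge_min; apply/orP; left.
by rewrite lerDr enorm_ge0.
Qed.

Lemma sup_halfspace_le1 (A : set (law R d)) u z :
  (ereal_sup [set (Q : law R d) (halfspace u z) | Q in A] <= 1)%E.
Proof.
apply: ge_ereal_sup => _ [Q _ <-]; apply: probability_le1.
exact: measurable_halfspace.
Qed.

(** If the mean cost [c] exceeds [delta], every admissible law leaves mass at least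
    [(c - delta) / M] outside. This is uniform in the law, so the supremum stays below 1. *)
Lemma sup_halfspaceP delta u z : enorm u = 1 ->
  ereal_sup [set (Q : law R d) (halfspace u z) |
             Q in [set Q | (wasserstein Q P <= delta%:E)%E]] = 1%E <->
  transport_cost R d n x u z <= delta * n%:R.
Proof.
move=> u1; split; last first.
  move=> /(exists_law_halfspace1 delta u z u1)[Q QP QH].
  apply/eqP; rewrite eq_le; apply/andP; split.
    exact: sup_halfspace_le1.
  by apply: ereal_sup_ubound; exists Q.
move=> sup1; rewrite leNgt; apply/negP => cost.
(* The sum dominates each of its nonnegative terms; adding [1] makes [M] a legitimate divisor. *)
pose M := 1 + transport_cost R d n x u z.
have M0 : 1 <= M.
  by rewrite lerDl; apply: sumr_ge0 => i _; rewrite le_max lexx.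
pose c := n%:R^-1 * transport_cost R d n x u z.
have c0 : 0 < c - delta by rewrite subr_gt0 ltr_pdivlMl // mulrC.
suff : (ereal_sup [set (Q : law R d) (halfspace u z) |
          Q in [set Q | (wasserstein Q P <= delta%:E)%E]] <=
        (1 - (c - delta) / M)%:E)%E.
  rewrite sup1 lee_fin lerBrDl gerDr leNgt divr_gt0 //.
  exact: lt_le_trans M0.
apply: ge_ereal_sup => _ [Q /= QP <-].
have hM i : Num.max 0 (dot u (z - x i)) <= M.
  rewrite /M /transport_cost (bigD1 i) //= addrCA lerDl addr_ge0 //.
  by apply: sumr_ge0 => j _; rewrite le_max lexx.
have := transport_cost_le_wasserstein Q u z M u1 hM (le_trans ler01 M0).
move/le_trans/(_ (leeD2r _ QP)).
have /fineK <- : Q (halfspace u z) \is a fin_num.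
  by apply: fin_num_measure; exact: measurable_halfspace.
rewrite -EFinB -EFinM -EFinD !lee_fin -/c => h.
rewrite lerBrDr -lerBrDl ler_pdivrMr; last exact: lt_le_trans M0.
by rewrite mulrC; lra.
Qed.

(** An infimum of values at most 1 equals 1 iff all of them do, given that a unit vector exists;
    over no directions it would be infinite. *)
Lemma robust_depth_eq1P delta z : (0 < d)%N ->
  robust_depth delta P z = 1%E <->
  (forall u, enorm u = 1 -> transport_cost R d n x u z <= delta * n%:R).
Proof.
move=> d_gt0; split=> [D1 u u1|h].
  apply/sup_halfspaceP => //; apply/eqP; rewrite eq_le; apply/andP; split.
    exact: sup_halfspace_le1.
  by rewrite -{1}D1; apply: ereal_inf_lbound; exists u.
rewrite /robust_depth; have [v v1] := exists_unit_vector R d d_gt0.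
apply/eqP; rewrite eq_le; apply/andP; split.
  apply: ereal_inf_lbound; exists v => //.
  by apply/sup_halfspaceP => //; exact: h.
apply: le_ereal_inf_tmp => _ [u u1 <-].
by rewrite (sup_halfspaceP delta u z u1).2 //; exact: h.
Qed.

Lemma median_region_bigcap delta : (0 < d)%N -> 0 <= delta ->
  median_region delta P =
  \bigcap_(I in [set I : {set 'I_n} | I != finset.set0]) ballI delta x I.
Proof.
move=> d_gt0 delta0; apply/seteqP; split=> z.
  move=> /(robust_depth_eq1P delta z d_gt0) h I.
  exact: ballI_transport_cost.
move=> h; apply/robust_depth_eq1P => //; apply: transport_cost_le => //.
by move=> I _; exact: h.
Qed.

End depth.

Theorem proposition10 (R : realType) (d n : nat)
    (d_gt0 : (0 < d)%N) (n_gt0 : (0 < n)%N) (x : 'I_n -> 'rV[R]_d) :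
  (forall delta : R, 0 < delta ->
     is_max_value (robust_depth delta (empirical n_gt0 x)) 1%E ->
     median_region delta (empirical n_gt0 x) =
       \bigcap_(I in [set I : {set 'I_n} |
                      separable_index x I /\ I != finset.set0])
         ballI delta x I
     /\
     \bigcap_(I in [set I : {set 'I_n} |
                    separable_index x I /\ I != finset.set0])
       ballI delta x I =
     \bigcap_(I in [set I : {set 'I_n} | I != finset.set0]) ballI delta x I)
  /\
  (exists2 delta0 : R, 0 < delta0 &
     forall delta : R, delta0 <= delta ->
       median_region delta (empirical n_gt0 x) =
         ecball (n%:R^-1 *: \sum_(i < n) x i) delta).
Proof.
have bigcapE (delta : R) : 0 <= delta ->
    \bigcap_(I in [set I : {set 'I_n} |
                   separable_index x I /\ I != finset.set0])
      ballI delta x I =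
    \bigcap_(I in [set I : {set 'I_n} | I != finset.set0]) ballI delta x I.
  move=> delta0; apply/seteqP; split=> z h I /=; last by case=> _; exact: h.
  (* The separable balls bound the transport cost in every direction, and this bound gives all the
     balls back. *)
  apply: ballI_transport_cost => //; apply: transport_cost_le => // J sJ J0.
  exact: h.
split=> [delta /ltW delta0 _|].
  by rewrite bigcapE // median_region_bigcap.
have [delta0 delta0_gt0 h] := bigcap_ballI_large R d n n_gt0 x.
exists delta0 => // delta hdelta; rewrite median_region_bigcap ?h //.
exact: le_trans (ltW delta0_gt0) hdelta.
Qed.
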